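(* Let $Z$ be a compact metrizable space and let $X\subseteq Z$ be a subspace. Then the hyperspace $K(X)$ is hereditarily Baire if and only if player I has no winning strategy in the $k$-Porada game $kP(Z,X)$.
   Context: $K(X)$ denotes the space of all nonempty compact subsets of $X$ with the Vietoris topology, whose basic open sets are $\langle U_0,\dots,U_n\rangle=\{K\in K(X): K\subseteq\bigcup_{i\le n}U_i \text{ and } K\cap U_i\ne\emptyset \text{ for every } i\le n\}$, with each $U_i$ open in $X$. A topological space is Baire if the intersection of every countable family of open dense subsets is dense; it is hereditarily Baire if every closed subspace is Baire. $k$-Porada game $kP(Z,X)$: players I and II alternate for $\omega$ many innings. In inning $n$, player I picks a pair $(K_n,U_n)$ with $K_n$ a nonempty compact subset of $X$, $U_n$ open in $Z$, $K_n\subseteq U_n$, and, if $n\ge1$, $U_n\subseteq V_{n-1}$. Player II responds with an open set $V_n$ in $Z$ with $K_n\subseteq V_n\subseteq U_n$. Player II wins if $\emptyset\ne\bigcap_{n\in\omega}U_n\subseteq X$; otherwise player I wins. A strategy of player I is a function giving a legal first move of player I and, for each finite sequence $(V_0,\dots,V_{n-1})$ of legal moves of player II made against the strategy, a legal next move of player I. (In particular, if player I has no legal first move, she has no strategy.) It is winning if player I wins every run in which she follows it. *)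

(* Defs.v *)
From HB Require Import structures.
From mathcomp Require Import all_boot all_order all_algebra.
From mathcomp Require Import boolp classical_sets functions cardinality reals topology.

Set Implicit Arguments.
Unset Strict Implicit.
Unset Printing Implicit Defensive.

Import Order.TTheory GRing.Theory Num.Theory.
Local Open Scope classical_set_scope.
Local Open Scope ring_scope.

Definition is_metric (R : realType) (T : Type) (d : T -> T -> R) : Prop :=
  [/\ forall x y, 0 <= d x y,
      forall x y, d x y = 0 <-> x = y,
      forall x y, d x y = d y x
    & forall x y z, d x z <= d x y + d y z].

Definition metrizable (R : realType) (T : topologicalType) : Prop :=
  exists2 d : T -> T -> R, is_metric d &
    forall A : set T, open A <->
      forall x, A x -> exists2 e : R, 0 < e & [set y | d x y < e] `<=` A.

Definition baire (T : topologicalType) : Prop :=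
  forall F : nat -> set T,
    (forall n, open (F n) /\ dense (F n)) -> dense (\bigcap_n F n).

(* [set_type C] carries the topology induced by [T]. *)
Definition hereditarily_baire (T : topologicalType) : Prop :=
  forall C : set T, closed C -> baire (set_type C).

Record hyperspace (T : topologicalType) := Hyperspace {
  hyperspace_set :> set T;
  hyperspace_neq0 : hyperspace_set !=set0;
  hyperspace_compact : compact hyperspace_set
}.

Lemma hyperspace_inj (T : topologicalType) : injective (@hyperspace_set T).
Proof.
move=> [K K0 cK] [L L0 cL] /= KL; subst L.
by congr Hyperspace; exact: Prop_irrelevance.
Qed.

Section vietoris.
Variable T : topologicalType.

HB.instance Definition _ := gen_eqMixin (hyperspace T).
HB.instance Definition _ := gen_choiceMixin (hyperspace T).

(* [vietoris_basic [:: U_0; ...; U_n]] is <U_0, ..., U_n>. *)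
Definition vietoris_basic (s : seq (set T)) : set (hyperspace T) :=
  [set K | K `<=` \bigcup_(U in [set` s]) U /\
           forall U, U \in s -> K `&` U !=set0].

Definition vietoris_index : set (seq (set T)) :=
  [set s | s <> [::] /\ forall U, U \in s -> open U].

Lemma vietoris_basic_cover :
  \bigcup_(s in vietoris_index) vietoris_basic s = setT.
Proof.
apply/seteqP; split=> // K _; exists [:: setT].
  by split=> // U; rewrite inE => /eqP ->; exact: openT.
split=> [x _|U].
  by exists setT => //=; rewrite inE.
by rewrite inE => /eqP ->; rewrite setIT; exact: hyperspace_neq0.
Qed.

Lemma vietoris_basic_join (s t : seq (set T)) (K : hyperspace T) :
  vietoris_index s -> vietoris_index t ->
  vietoris_basic s K -> vietoris_basic t K ->
  exists r, [/\ vietoris_index r, vietoris_basic r K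
              & vietoris_basic r `<=` vietoris_basic s `&` vietoris_basic t].
Proof.
move=> [s0 os] [t0 ot] [Ks sK] [Kt tK].
pose S := \bigcup_(U in [set` s]) U; pose S' := \bigcup_(U in [set` t]) U.
have oS : open S by apply: bigcup_open => U; exact: os.
have oS' : open S' by apply: bigcup_open => U; exact: ot.
pose r := [seq U `&` S' | U <- s] ++ [seq U `&` S | U <- t].
have rS U : U \in r -> U `<=` S `&` S'.
  rewrite mem_cat => /orP[] /mapP[V Vin ->] x [Vx ?]; split=> //;
  by exists V.
exists r; split.
- split; first by rewrite /r; case: (s) s0.
  move=> U; rewrite mem_cat => /orP[] /mapP[V Vin ->]; apply: openI => //.
    exact: os.
  exact: ot.
- split.
    move=> x Kx; have [U Us Ux] := Ks x Kx; exists (U `&` S').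
      by rewrite /= mem_cat (map_f (fun V => V `&` S')) ?Us.
    by split=> //; exact: Kt.
  move=> U; rewrite mem_cat => /orP[] /mapP[V Vin ->].
    by have [x [Kx Vx]] := sK _ Vin; exists x; split=> //; split=> //; exact: Kt.
  by have [x [Kx Vx]] := tK _ Vin; exists x; split=> //; split=> //; exact: Ks.
- move=> L [Lr rL]; split; split.
  + by move=> x /Lr [U /rS Ur /Ur []].
  + move=> U Us; have [|x [Lx [Ux _]]] := rL (U `&` S').
      by rewrite mem_cat (map_f (fun V => V `&` S')) ?Us.
    by exists x.
  + by move=> x /Lr [U /rS Ur /Ur []].
  + move=> U Ut; have [|x [Lx [Ux _]]] := rL (U `&` S).
      by rewrite mem_cat (map_f (fun V => V `&` S)) ?orbT.
    by exists x.
Qed.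

Let vietoris_pointed : pointedType :=
  HB.pack_for pointedType (seq (set T)) (isPointed.Build (seq (set T)) [::]).

HB.instance Definition _ := @isBaseTopological.Build (hyperspace T)
  vietoris_pointed vietoris_index vietoris_basic
  vietoris_basic_cover vietoris_basic_join.

End vietoris.

Section k_porada_game.
Variables (Z : topologicalType) (X : set Z).

(* A move of player I is a pair (K, U); [W] is the previous move of player II,
   or [setT] in the first inning. *)
Definition legalI (W : set Z) (m : set Z * set Z) : Prop :=
  [/\ m.1 !=set0, compact m.1 & m.1 `<=` X] /\
  [/\ open m.2, m.1 `<=` m.2 & m.2 `<=` W].

Definition legalII (m : set Z * set Z) (V : set Z) : Prop :=
  [/\ open V, m.1 `<=` V & V `<=` m.2].

Definition legal_against (sigma : seq (set Z) -> set Z * set Z)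
    (s : seq (set Z)) : Prop :=
  forall i, (i < size s)%N -> legalII (sigma (take i s)) (nth setT s i).

(* [sigma s] is player I's answer to [s = [:: V_0; ...; V_(n-1)]]; only its
   values on sequences of legal moves matter. *)
Definition strategyI (sigma : seq (set Z) -> set Z * set Z) : Prop :=
  forall s, legal_against sigma s -> legalI (last setT s) (sigma s).

Definition player_II_wins (U : nat -> set Z) : Prop :=
  \bigcap_n U n !=set0 /\ \bigcap_n U n `<=` X.

Definition winning_strategyI (sigma : seq (set Z) -> set Z * set Z) : Prop :=
  strategyI sigma /\
  forall V : nat -> set Z,
    (forall n, legalII (sigma (mkseq V n)) (V n)) ->
    ~ player_II_wins (fun n => (sigma (mkseq V n)).2).

End k_porada_game.

(* Main.v *)
Require Import Defs.
From mathcomp Require Import all_boot all_order all_algebra.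
From mathcomp Require Import boolp classical_sets functions cardinality reals topology.

Set Implicit Arguments.
Unset Strict Implicit.
Unset Printing Implicit Defensive.

Import Order.TTheory GRing.Theory Num.Theory.
Local Open Scope classical_set_scope.
Local Open Scope ring_scope.

(** If a closed subspace C of K(X) is not Baire, witnessed by an open set O and
    dense open sets G_n of C, player I plays K_n in C together with open sets W_n
    of K(X) such that K_n is in W_n, W_0 = O and the closure of W_(n+1) lies in
    the intersection of W_n and G_n, and she keeps the closure of U_(n+1) inside
    V_n.  Were player II to win, the intersection of the U_n would be contained
    in X, so (K_n) would cluster in K(X) at a point of C lying in O and in every
    G_n.

    Conversely, let I follow a winning strategy while II shrinks V_n to K_n, the
    j-th reply being contained in the 1/(n+j+1)-thickening of K_n.  This gives a
    tree of positions indexed by finite sequences of integers; let L_s be the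
    union of the sets K_t over the prefixes t of s.  Then L_(s^j) tends to L_s.
    No compact M in X contains the K_t along an infinite branch: a point of the
    intersection of the U_t along the branch would lie in the closure of the
    union of the K_t, hence in M, and II would win.  So the countable set of all
    L_s is closed in K(X) and has no isolated point, hence is not Baire. *)

(** * Thickenings in a metrizable space *)

Section metric.
Variables (R : realType) (Z : topologicalType) (d : Z -> Z -> R).
Hypothesis dm : is_metric d.
Hypothesis dopen : forall A : set Z, open A <->
  forall x, A x -> exists2 e : R, 0 < e & [set y | d x y < e] `<=` A.

Lemma exists_invS_lt (e : R) : 0 < e -> exists n, n.+1%:R^-1 < e.
Proof.
move=> e0; exists (Num.Def.archi_bound e^-1).
rewrite invf_plt ?posrE ?ltr0Sn//; apply: lt_trans (archi_boundP _) _.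
  by rewrite invr_ge0 ltW.
by rewrite ltr_nat.
Qed.

(** Radii 1/(n+1) suffice: around a compact [K] these sets form a neighbourhood base, so integers
    can number the replies of player II. *)
Definition thickening (K : set Z) (n : nat) : set Z :=
  [set y | exists2 x, K x & d x y < n.+1%:R^-1].

Lemma metric_ball_open x e : open [set y | d x y < e].
Proof.
have [_ _ _ tri] := dm; apply/dopen => y /= dxy.
exists (e - d x y); first by rewrite subr_gt0.
move=> z /= dyz; apply: le_lt_trans (tri x y z) _.
by rewrite -ltrBrDl.
Qed.

Lemma metric_nbhsP x (A : set Z) :
  nbhs x A -> exists2 e : R, 0 < e & [set y | d x y < e] `<=` A.
Proof.
rewrite nbhsE => -[B [oB Bx] BA].
have [e e0 xeB] := (dopen B).1 oB x Bx.
by exists e => // y /xeB /BA.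
Qed.

Lemma metric_nbhs_ball x e : 0 < e -> nbhs x [set y | d x y < e].
Proof.
have [_ d0 _ _] := dm.
by move=> e0; apply: open_nbhs_nbhs; split;
  [exact: metric_ball_open | rewrite /= (d0 x x).2].
Qed.

Lemma open_thickening K n : open (thickening K n).
Proof.
rewrite (_ : thickening K n = \bigcup_(x in K) [set y | d x y < n.+1%:R^-1]).
  by apply: bigcup_open => x _; exact: metric_ball_open.
by apply/seteqP; split=> y [x Kx xy]; exists x.
Qed.

Lemma sub_thickening K n : K `<=` thickening K n.
Proof.
have [_ d0 _ _] := dm => x Kx; exists x => //.
by rewrite (d0 x x).2// invr_gt0 ltr0Sn.
Qed.

Lemma thickeningS K L n : K `<=` L -> thickening K n `<=` thickening L n.
Proof. by move=> KL y [x /KL Lx xy]; exists x. Qed.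

Lemma le_thickening K m n : (m <= n)%N -> thickening K n `<=` thickening K m.
Proof.
move=> mn y [x Kx xy]; exists x => //; apply: lt_le_trans xy _.
by rewrite lef_pV2 ?posrE ?ltr0Sn// ler_nat ltnS.
Qed.

(** The index [n.*2.+1] has radius 1/(2n+2), half of 1/(n+1); the other half pays for the passage to
    the closure. *)
Lemma closure_thickening K n :
  closure (thickening K n.*2.+1) `<=` thickening K n.
Proof.
have [_ _ ds tri] := dm => y cy.
have e0 : 0 < n.*2.+2%:R^-1 :> R by rewrite invr_gt0 ltr0Sn.
have [z [[x Kx xz] /= yz]] := cy _ (metric_nbhs_ball y e0).
exists x => //; apply: le_lt_trans (tri x z y) _.
rewrite (_ : n.+1%:R^-1 = n.*2.+2%:R^-1 + n.*2.+2%:R^-1 :> R).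
  by apply: ltrD => //; rewrite ds.
by rewrite -doubleS -muln2 natrM invfM -splitr.
Qed.

Lemma bigcap_thickening K y : (forall n, thickening K n y) -> closure K y.
Proof.
move=> Ky B /metric_nbhsP[e e0 yB].
have [n ne] := exists_invS_lt e0; have [x Kx xy] := Ky n.
have [_ _ ds _] := dm.
by exists x; split=> //; apply: yB; rewrite /= ds; exact: lt_trans ne.
Qed.

(** Each point of [K] has a half ball on which one radius works; compactness in its near-covering
    form makes that radius uniform. *)
Lemma compact_thickening K U : compact K -> open U -> K `<=` U ->
  exists n, thickening K n `<=` U.
Proof.
have [_ _ _ tri] := dm => cK oU KU.
have /compact_near_coveringP cov := cK.
have [] := cov nat \oo (fun n x => [set y | d x y < n.+1%:R^-1] `<=` U) _ _.
  move=> x /KU Ux; have [e e0 xU] := (dopen U).1 oU x Ux.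
  have e20 : 0 < e / 2 by rewrite divr_gt0.
  have [n ne] := exists_invS_lt e20.
  exists ([set y | d x y < e / 2], [set m | (n <= m)%N]).
    by split; [exact: metric_nbhs_ball | exists n].
  move=> [y m] /= [xy nm] z /= yz; apply: xU => /=.
  apply: le_lt_trans (tri x y z) _; rewrite [e]splitr; apply: ltrD => //.
  apply: lt_le_trans yz _; apply: le_trans (ltW ne).
  by rewrite lef_pV2 ?posrE ?ltr0Sn// ler_nat ltnS.
move=> n _ nU; exists n => y [x Kx xy].
exact: (nU n (leqnn n) x Kx).
Qed.

Lemma metric_hausdorff : hausdorff_space Z.
Proof.
have [dge0 d0 ds tri] := dm => x y xy.
apply/d0/eqP; rewrite eq_le dge0 andbT leNgt; apply/negP => dxy.
have e0 : 0 < d x y / 2 by rewrite divr_gt0.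
have [z [/= xz yz]] := xy _ _ (metric_nbhs_ball x e0) (metric_nbhs_ball y e0).
have := tri x z y; rewrite leNgt => /negP; apply.
by rewrite [ltRHS]splitr ltrD// ds.
Qed.

Lemma compact_shrink K U n : compact K -> open U -> K `<=` U ->
  exists V, [/\ open V, K `<=` V, closure V `<=` U & V `<=` thickening K n].
Proof.
move=> cK oU KU; have [m mU] := compact_thickening cK oU KU.
(* The maximum serves both inclusions: [m] puts the closure inside [U], [n] bounds the distance from
   [K]. *)
exists (thickening K (maxn m n).*2.+1); split.
- exact: open_thickening.
- exact: sub_thickening.
- by move=> y /closure_thickening /(le_thickening (leq_maxl _ _)) /mU.
- apply: le_thickening.
  by rewrite -addnn -addnS (leq_trans (leq_maxr m n))// leq_addr.
Qed.

End metric.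

(** * The hyperspace of a subspace, seen in the ambient space *)

Section hyperspace_of_subspace.
Variables (Z : topologicalType) (X : set Z).
Local Notation H := (hyperspace (set_type X)).

Definition trace (K : H) : set Z := set_val @` (K : set (set_type X)).

Lemma trace_sub K : trace K `<=` X.
Proof. by move=> _ [x _ <-]; exact: set_valP. Qed.

Lemma trace_neq0 K : trace K !=set0.
Proof. by have [x Kx] := hyperspace_neq0 K; exists (set_val x), x. Qed.

Lemma trace_compact K : compact (trace K).
Proof.
apply: continuous_compact; last exact: hyperspace_compact.
by apply: continuous_subspaceT; exact: initial_continuous.
Qed.

Lemma trace_inj : injective trace.
Proof.
move=> K L KL; apply: hyperspace_inj; apply/seteqP.
by split=> x Kx; [have : trace L (set_val x) by rewrite -KL; exists x
  |have : trace K (set_val x) by rewrite KL; exists x] => -[y ? /val_inj <-].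
Qed.

Lemma trace_surj A : A !=set0 -> compact A -> A `<=` X ->
  exists K : H, trace K = A.
Proof.
move=> [a Aa] cA AX.
have lift z : A z -> exists x : set_type X, set_val x = z.
  by move=> /AX /mem_set Xz; exists (exist _ z Xz).
have B0 : (set_val @^-1` A : set (set_type X)) !=set0.
  by have [x xa] := lift a Aa; exists x; rewrite /= xa.
have cB : compact (set_val @^-1` A : set (set_type X)).
  (* The image filter on [Z] clusters at a point of [A], which lies in [X] and so lifts to the
     subtype. *)
  move=> F PF FA.
  have [z [Az clz]] := cA (set_val @ F) _ FA.
  have [x xz] := lift z Az; exists x; split; first by rewrite /= xz.
  move=> B C FB [_ [[D oD <-] /= Dx] DC].
  have [||y [[u Bu <-] Du]] := clz (set_val @` B) D.
  - by apply: (@filterS _ F _ B) => // u Bu; exists u.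
  - by apply: open_nbhs_nbhs; split; [|rewrite -xz].
  - by exists u; split=> //; exact: DC.
exists (Hyperspace B0 cB); apply/seteqP; split=> [_ [x ? <-]//|z Az].
by have [x xz] := lift z Az; exists x; rewrite //= xz.
Qed.

Lemma open_trace_sub (U : set Z) : open U -> open [set K | trace K `<=` U].
Proof.
move=> oU.
have oP : open (set_val @^-1` U : set (set_type X)) by exists U.
exists [set [:: set_val @^-1` U]].
  by move=> _ ->; split=> // V; rewrite inE => /eqP ->.
apply/seteqP; split=> [K [_ -> [Ks _]] _ [x Kx <-]|K KU].
  by have [V] := Ks x Kx; rewrite /= inE => /eqP ->.
exists [:: set_val @^-1` U] => //; split=> [x Kx|V].
  by exists (set_val @^-1` U); rewrite /= ?inE//; apply: KU; exists x.
rewrite inE => /eqP ->; have [x Kx] := hyperspace_neq0 K.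
by exists x; split=> //; apply: KU; exists x.
Qed.

Lemma open_trace_meet (U : set Z) : open U -> open [set K | trace K `&` U !=set0].
Proof.
move=> oU.
have oP : open (set_val @^-1` U : set (set_type X)) by exists U.
exists [set [:: setT; set_val @^-1` U]].
  move=> _ ->; split=> // V; rewrite !inE => /orP[] /eqP -> //; exact: openT.
apply/seteqP; split=> [K [_ -> [_ Ks]]|K [_ [[x Kx <-] Ux]]].
  have [|x [Kx Ux]] := Ks (set_val @^-1` U); first by rewrite !inE eqxx orbT.
  by exists (set_val x); split=> //; exists x.
exists [:: setT; set_val @^-1` U] => //; split=> [y _|V].
  by exists setT; rewrite //= inE eqxx.
rewrite !inE => /orP[] /eqP ->; last by exists x.
by rewrite setIT; exact: hyperspace_neq0.
Qed.

Lemma closed_trace_sub (U : set Z) : closed U -> closed [set K | trace K `<=` U].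
Proof.
move=> cU; rewrite -openC (_ : ~` _ = [set K | trace K `&` ~` U !=set0]).
  by apply: open_trace_meet; rewrite openC.
apply/seteqP; split=> [K /nonsubset[x ?]|K [x [Kx nUx]] /(_ x Kx) //].
by exists x.
Qed.

Lemma closed_trace_meet (U : set Z) :
  closed U -> closed [set K | trace K `&` U !=set0].
Proof.
move=> cU; rewrite -openC (_ : ~` _ = [set K | trace K `<=` ~` U]).
  by apply: open_trace_sub; rewrite openC.
apply/seteqP; split=> K /= KU; first by move=> x Kx Ux; apply: KU; exists x.
by move=> [x [/KU]].
Qed.

(** The open sets of the subspace in a basic neighbourhood are extended to open sets of [Z]; [G] is
    the union of the extensions. *)
Lemma nbhs_trace (K : H) (W : set H) : nbhs K W ->
  exists G (s : seq (set Z)),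
  [/\ open G /\ trace K `<=` G,
      forall U, U \in s -> open U /\ trace K `&` U !=set0
    & forall L, trace L `<=` G ->
        (forall U, U \in s -> trace L `&` U !=set0) -> W L].
Proof.
case=> B [[D DP <-] [t Dt [Kt tK]] BW].
have /choice[g gP] : forall U : set (set_type X), exists V : set Z,
    open U -> open V /\ set_val @^-1` V = U.
  move=> U; have [[V oV VU]|nU] := pselect (open U); first by exists V.
  by exists setT => /nU.
have [_ ot] := DP t Dt.
exists (\bigcup_(U in [set` t]) g U), (map g t); split.
- split; first by apply: bigcup_open => U /ot /gP[].
  move=> _ [x Kx <-]; have [U tU Ux] := Kt x Kx; exists U => //.
  by have [_ gU] := gP U (ot U tU); move: Ux; rewrite -{1}gU.
- move=> _ /mapP[U tU ->]; have [og gU] := gP U (ot U tU); split=> //.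
  have [x [Kx Ux]] := tK U tU; exists (set_val x); split; first by exists x.
  by move: Ux; rewrite -{1}gU.
move=> L Lg tL; apply: BW; exists t => //; split=> [x Lx|U tU].
  have [|U tU gUx] := Lg (set_val x); first by exists x.
  by exists U => //; have [_ <-] := gP U (ot U tU).
have [_ [[x Lx <-] gUx]] := tL (g U) (map_f g tU).
by exists x; split=> //; have [_ <-] := gP U (ot U tU).
Qed.

(** A point of one trace outside the other separates them, by the condition of meeting the
    complement of [trace L] or of avoiding a point of it. *)
Lemma hyperspace_T1 (K L : H) : hausdorff_space Z -> K <> L ->
  exists2 W : set H, open W & W K /\ ~ W L.
Proof.
move=> hZ KL.
have [KsubL|/nonsubset[x [Kx Lx]]] := pselect (trace K `<=` trace L); last first.
  exists [set M | trace M `&` ~` trace L !=set0].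
    apply: open_trace_meet; rewrite openC.
    by apply: compact_closed => //; exact: trace_compact.
  by split; [exists x | move=> -[y []]].
have [LK|/nonsubset[x [Lx Kx]]] := pselect (trace L `<=` trace K).
  by exfalso; apply/KL/trace_inj/seteqP.
exists [set M | trace M `<=` ~` [set x]].
  apply: open_trace_sub; rewrite openC.
  exact/accessible_closed_set1/hausdorff_accessible.
by split=> [y Ky yx|/(_ x Lx)]; [apply: Kx; rewrite -yx | exact].
Qed.

Lemma closed_hyperspace1 (K : H) : hausdorff_space Z -> closed [set K].
Proof.
move=> hZ L clL; apply: contrapT => LK.
have [W oW [WL nWK]] := hyperspace_T1 hZ LK.
by have [_ [-> /nWK]] := clL W (open_nbhs_nbhs (conj oW WL)).
Qed.

End hyperspace_of_subspace.

(** * Regularity of the hyperspace *)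

Section regularity.
Variables (Z : topologicalType) (X : set Z).
Local Notation H := (hyperspace (set_type X)).
Hypothesis shrinking : forall K U : set Z, compact K -> open U -> K `<=` U ->
  exists V, [/\ open V, K `<=` V & closure V `<=` U].

(** Shrink [G] around the trace of [K], and each [U] around one point of that trace. The closed
    conditions on the closures of the shrunk sets still force membership in [W]. *)
Lemma hyperspace_regular (K : H) (W : set H) : nbhs K W ->
  exists W' : set H, [/\ open W', W' K & closure W' `<=` W].
Proof.
move=> /nbhs_trace[G [s [[oG KG] sP GsW]]].
have [G' [oG' KG' G'G]] := shrinking (@trace_compact _ _ K) oG KG.
have /choice[g gP] : forall U : set Z, exists V : set Z,
    open U -> trace K `&` U !=set0 ->
    [/\ open V, trace K `&` V !=set0 & closure V `<=` U].
  move=> U.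
  have [[oU [x [Kx Ux]]]|nU] := pselect (open U /\ trace K `&` U !=set0);
    last by exists setT => oU KU; exfalso; exact: nU.
  have [|V [oV xV VU]] := shrinking (@compact_set1 _ x) oU; first by move=> _ ->.
  by exists V => _ _; split=> //; exists x; split=> //; exact: xV.
have gsP U : U \in s ->
    [/\ open (g U), trace K `&` g U !=set0 & closure (g U) `<=` U].
  by move=> /sP[]; exact: gP.
pose W' := [set L : H | trace L `<=` G'] `&`
  \bigcap_(U in [set` s]) [set L : H | trace L `&` g U !=set0].
pose F := [set L : H | trace L `<=` closure G'] `&`
  \bigcap_(U in [set` s]) [set L : H | trace L `&` closure (g U) !=set0].
exists W'; split.
- apply: openI; first exact: open_trace_sub.
  rewrite bigcap_seq big_seq; apply: big_ind.
  + exact: openT.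
  + by move=> ? ?; exact: openI.
  + by move=> U /gsP[? _ _]; exact: open_trace_meet.
- by split=> // U /gsP[].
have cF : closed F.
  apply: closedI; first by apply: closed_trace_sub; exact: closed_closure.
  by apply: closed_bigI => U _; apply: closed_trace_meet; exact: closed_closure.
have W'F : W' `<=` F.
  move=> L [LG' Ls]; split; first exact: subset_trans LG' (@subset_closure _ G').
  by move=> U /Ls[x [Lx gx]]; exists x; split=> //; exact: subset_closure.
move=> L /(closureS W'F) /cF[LG' Ls]; apply: GsW; first exact: subset_trans G'G.
move=> U sU; have [x [Lx gx]] := Ls U sU; exists x; split=> //.
by have [_ _] := gsP U sU; apply.
Qed.

End regularity.

(** * From a non-Baire closed set to a strategy *)

Section limits.
Variables (Z : topologicalType) (X : set Z).
Local Notation H := (hyperspace (set_type X)).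

(* The last hypothesis makes every limit point of F in the compact space K(Z) a
   subset of X. *)
Lemma hyperspace_cluster (F : set_system H) : compact [set: Z] ->
  ProperFilter F ->
  (forall z, (forall A, closed A -> F [set K | trace K `<=` A] -> A z) -> X z) ->
  cluster F !=set0.
Proof.
move=> Zc PF FX; have [Q [UQ FQ]] := ultraFilterLemma PF.
(* L is the limit of the ultrafilter Q in the Vietoris topology of K(Z). *)
pose L : set Z :=
  [set z : Z | forall N : set Z, nbhs z N -> Q [set K | trace K `&` N !=set0]].
(* As [Q] is an ultrafilter, a point outside [L] has a neighbourhood missed by [Q]-almost every [K];
   compactness of the complement of [G] reduces to finitely many of these. *)
have Lsub G : open G -> L `<=` G -> Q [set K | trace K `<=` G].
  move=> oG LG.
  have /compact_near_coveringP cov : compact (~` G).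
    by apply: (subclosed_compact _ Zc) => //; exact: open_closedC.
  have : \forall K \near Q, ~` G `<=` (fun z => ~ trace K z).
    apply: (cov _ Q (fun K z => ~ trace K z)) => z Gz.
    have /existsNP[N /not_implyP[Nz QN]] : ~ L z by move/LG.
    exists (N, [set K | ~ (trace K `&` N !=set0)]) => /=.
      by split=> //; have [] := in_ultra_setVsetC [set K | trace K `&` N !=set0] UQ.
    by move=> [y K] /= [Ny KN] Ky; apply: KN; exists y.
  apply: filterS => K KG z Kz; apply: contrapT => Gz; exact: (KG z Gz Kz).
have subL A : closed A -> Q [set K | trace K `<=` A] -> L `<=` A.
  move=> cA QA z Lz; apply: contrapT => Az.
  have QA' : Q [set K | trace K `&` ~` A !=set0].
    by apply: Lz; apply: open_nbhs_nbhs; split=> //; exact: closed_openC.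
  by have [K [/= KA [y [/KA]]]] := filter_ex (filterI QA QA').
have cL : closed L.
  move=> z clz N; rewrite nbhsE => -[O [oO Oz] ON].
  have [y [Ly Oy]] := clz O (open_nbhs_nbhs (conj oO Oz)).
  apply: filterS (Ly O (open_nbhs_nbhs (conj oO Oy))) => K [x [Kx Ox]].
  by exists x; split=> //; exact: ON.
have L0 : L !=set0.
  apply/set0P/negP => /eqP L0.
  have [|K /= K0] := filter_ex (Lsub set0 open0 _); first by rewrite L0.
  by have [x /K0] := trace_neq0 K.
have LX : L `<=` X.
  by move=> z Lz; apply: FX => A cA FA; apply: subL Lz => //; exact: FQ.
have [M ML] := trace_surj L0 (subclosed_compact cL Zc (@subsetT _ _)) LX.
exists M => A B FA /nbhs_trace[G [s [[oG MG] sP GsB]]].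
have QB : Q B.
  have Qs : Q (\bigcap_(U in [set` s]) [set K | trace K `&` U !=set0]).
    rewrite bigcap_seq big_seq; apply: big_ind.
    - exact: filterT.
    - by move=> ? ?; exact: filterI.
    - move=> U /sP[oU [x [Mx Ux]]]; move: Mx; rewrite ML; apply.
      exact: open_nbhs_nbhs.
  have QG : Q [set K | trace K `<=` G] by apply: Lsub; rewrite // -ML.
  by apply: filterS (filterI QG Qs) => K [KG Ks]; exact: GsB.
exact: filter_ex (filterI (FQ _ FA) QB).
Qed.

End limits.

Lemma not_baire_set_type (T : topologicalType) (C : set T) : ~ baire (set_type C) ->
  exists (G : nat -> set T) (O : set T), [/\ forall n, open (G n),
    forall n W x, open W -> C x -> W x -> C `&` W `&` G n !=set0,
    open O, C `&` O !=set0 & forall x, C x -> O x -> ~ forall n, G n x].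
Proof.
move=> /existsNP[F /not_implyP[Fod /existsNP[O' /not_implyP[[y O'y]]]]].
move=> /not_implyP[[O oO OO'] FO'].
have /choice[G GP] : forall n, exists G, open G /\ set_val @^-1` G = F n.
  by move=> n; have [[G oG GF] _] := Fod n; exists G.
exists G, O; split=> //.
- by move=> n; have [] := GP n.
- move=> n W x oW Cx Wx; have [_ dF] := Fod n.
  have [||z [Wz Fz]] := dF (set_val @^-1` W).
  + by exists (exist _ x (mem_set Cx)).
  + by exists W.
  exists (set_val z); split; first by split=> //; exact: set_valP.
  by have [_] := GP n; move: Fz => /[swap] <-.
- by exists (set_val y); split; [exact: set_valP|move: O'y; rewrite -OO'].
move=> x Cx Ox Gx; apply: FO'; exists (exist _ x (mem_set Cx)); split.
  by rewrite -OO'.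
by move=> n _; have [_ <-] := GP n; exact: Gx.
Qed.

Section strategy_from_closed_set.
Variables (Z : topologicalType) (X : set Z).
Local Notation H := (hyperspace (set_type X)).
Hypothesis Zcompact : compact [set: Z].
Hypothesis shrinking : forall K U : set Z, compact K -> open U -> K `<=` U ->
  exists V, [/\ open V, K `<=` V & closure V `<=` U].

(* The list is in reverse order: its head is the last move of player II. *)
Fixpoint replay (S : Type) (next : nat -> S -> set Z -> S) (init : S)
    (s : seq (set Z)) : S :=
  if s is V :: s' then next (size s') (replay next init s') V else init.

Lemma not_hereditarily_baire_strategy : ~ hereditarily_baire H ->
  exists sigma, winning_strategyI X sigma.
Proof.
move=> /existsNP[C /not_implyP[cC /not_baire_set_type[G [O]]]].
move=> [oG dG oO [K0 [CK0 OK0]] CO].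
(* A state is the triple (K_n, W_n, U_n). *)
pose inv (p : H * set H * set Z) :=
  [/\ C p.1.1, open p.1.2, p.1.2 p.1.1, open p.2 & trace p.1.1 `<=` p.2].
have /choice[next nextP] : forall q : nat * (H * set H * set Z) * set Z,
    exists p', inv q.1.2 -> open q.2 -> trace q.1.2.1.1 `<=` q.2 ->
    [/\ inv p', closure p'.1.2 `<=` q.1.2.1.2 `&` G q.1.1 & closure p'.2 `<=` q.2].
  move=> [[n p] V] /=; have [[[CK oW WK _ _] oV KV]|np] :=
    pselect [/\ inv p, open V & trace p.1.1 `<=` V]; last first.
    by exists p => *; exfalso; exact: np.
  (* Density of G_n in [C] is applied to the part of [W] whose members have their trace inside
     [V]. *)
  have [K' [[CK' [WK' VK']] GK']] := dG n _ _
    (openI oW (@open_trace_sub _ X _ oV)) CK (conj WK KV).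
  have [W' [oW' W'K' W'W]] := hyperspace_regular shrinking
    (open_nbhs_nbhs (conj (openI oW (oG n)) (conj WK' GK'))).
  have [U' [oU' KU' U'V]] := shrinking (@trace_compact _ _ K') oV VK'.
  by exists (K', W', U') => _ _ _; split.
pose nxt n p V := next (n, p, V).
pose st s := replay nxt (K0, O, setT) (rev s).
pose sigma s := (trace (st s).1.1, (st s).2).
have stS s V : st (rcons s V) = nxt (size s) (st s) V.
  by rewrite /st rev_rcons /= size_rev.
have nxtP n p V : inv p -> legalII (trace p.1.1, p.2) V ->
    [/\ inv (nxt n p V), closure (nxt n p V).1.2 `<=` p.1.2 `&` G n
      & closure (nxt n p V).2 `<=` V].
  by move=> ip [oV KV _]; exact: (nextP (n, p, V)).
have inv0 : inv (K0, O, setT) by split=> //; exact: openT.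
have legal_inv s : legal_against sigma s -> inv (st s) /\ (st s).2 `<=` last setT s.
  elim/last_ind: s => [_|s V IH leg]; first by split.
  have [|is_ _] := IH.
    move=> i si; have := leg i; rewrite size_rcons ltnS => /(_ (ltnW si)).
    by rewrite nth_rcons si -cats1 takel_cat// ltnW.
  have := leg (size s); rewrite size_rcons leqnn => /(_ isT).
  rewrite nth_rcons ltnn eqxx -cats1 take_size_cat// => lV.
  have [i' _ cV] := nxtP (size s) _ _ is_ lV.
  rewrite cats1 stS last_rcons; split=> //; apply: subset_trans cV.
  exact: subset_closure.
exists sigma; split.
  move=> s /legal_inv[[? ? ? oU KU] sV]; split; split=> //=.
  - exact: trace_neq0.
  - exact: trace_compact.
  - exact: trace_sub.
move=> V Vleg [_ UX].
pose p n := st (mkseq V n).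
have pS n : p n.+1 = nxt n (p n) (V n).
  by rewrite /p mkseqS stS size_mkseq.
have pinv n : inv (p n).
  elim: n => [//|n IH]; rewrite pS.
  by have [] := nxtP n (p n) (V n) IH (Vleg n).
have pP n := nxtP n (p n) (V n) (pinv n) (Vleg n).
have W_step n : closure (p n.+1).1.2 `<=` (p n).1.2 `&` G n.
  by rewrite pS; have [] := pP n.
have U_step n : closure (p n.+1).2 `<=` (p n).2.
  by rewrite pS => z; have [_ _ cV] := pP n => /cV; have [_ _] := Vleg n; apply.
have W_mono m n : (p (n + m)%N).1.2 `<=` (p n).1.2.
  elim: m => [|m IH]; first by rewrite addn0.
  rewrite addnS => K WK; apply: IH.
  by have [] := W_step (n + m)%N K (subset_closure WK).
have U_mono m n : (p (n + m)%N).2 `<=` (p n).2.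
  elim: m => [|m IH]; first by rewrite addn0.
  rewrite addnS => K UK; apply: IH; apply: U_step; exact: subset_closure.
have tail (A : set H) n : (forall m, A (p (n + m)%N).1.1) ->
    ((fun n => (p n).1.1) @ \oo) A.
  move=> Ap; exists n => // m /= nm; rewrite -(subnKC nm); exact: Ap.
(* A point of every closed set that eventually contains the K_n is in the closure of each U_(n+1),
   hence in each U_n, hence in [X]. *)
have [] := @hyperspace_cluster _ X ((fun n => (p n).1.1) @ \oo) Zcompact _ _.
  move=> z zA; apply: UX => n _; apply: U_step; apply: zA.
    exact: closed_closure.
  apply: (@tail _ n.+1) => m; have [_ _ _ _ pU] := pinv (n.+1 + m)%N.
  by apply: subset_trans pU _; apply: subset_trans (@subset_closure _ _); exact: U_mono.
move=> M clM.
(* The cluster point inherits every closed condition satisfied by a tail of the K_n. *)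
have Mcl (A : set H) n : (forall m, A (p (n + m)%N).1.1) -> closure A M.
  by move=> /tail Ap B /(clM A B Ap).
have MW n : closure (p n).1.2 M.
  apply: (Mcl _ n) => m; apply: (W_mono m).
  by have [] := pinv (n + m)%N.
apply: (CO M).
- by apply: cC; apply: (Mcl _ 0%N) => m; have [] := pinv m.
- by have [] := W_step 0%N M (MW 1%N).
- by move=> n; have [] := W_step n M (MW n.+1).
Qed.

End strategy_from_closed_set.

(** * From a winning strategy to a countable crowded closed set *)

(** Removing one point of the range leaves a dense open set, and countably many removals leave
    nothing. As [x] need not be injective, crowdedness compares values and not indices. *)
Lemma not_baire_countable (T : topologicalType) (J : countType) (x : J -> T) :
  J -> (forall i, closed [set x i]) ->
  (forall i W, nbhs (x i) W -> exists2 j, W (x j) & x j <> x i) ->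
  ~ baire (set_type (range x)).
Proof.
move=> i0 x1 crowded bC.
pose C := set_type (range x).
(* An integer that codes no index removes no point. *)
pose F n := [set c : C | forall i, unpickle n = Some i -> set_val c <> x i].
have pt (i : J) : C by exists (x i); apply/mem_set; exists i.
have [|||c [_ Fc]] := bC F _ setT; last 1 first.
  have [i _ xi] := set_valP c.
  by have /(_ i (pickleK i)) := Fc (pickle i) I; rewrite xi.
- move=> n; split.
    case E : (unpickle n) => [i|]; last first.
      have -> : F n = setT by apply/seteqP; split=> // c _ i; rewrite E.
      exact: openT.
    exists (~` [set x i]); first exact: closed_openC.
    apply/seteqP; split=> c /= ci; first by move=> i'; rewrite E => -[<-].
    exact: ci.
  move=> O [c Oc] [W oW WO]; move: Oc; rewrite -{}WO => Wc.
  have [Fc|/existsNP[i /not_implyP[ni /contrapT ci]]] := pselect (F n c).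
    by exists c.
  have [|j Wj ji] := crowded i W.
    by apply: open_nbhs_nbhs; split=> //; rewrite -ci.
  have xj : range x (x j) by exists j.
  exists (exist _ (x j) (mem_set xj)); split=> //.
  by move=> i'; rewrite ni => -[<-].
- by exists (pt i0).
- exact: openT.
Qed.

(** * The tree of positions and its unions of compact sets *)

Section closed_set_from_strategy.
Variables (R : realType) (Z : topologicalType) (d : Z -> Z -> R) (X : set Z).
Local Notation H := (hyperspace (set_type X)).
Hypothesis dm : is_metric d.
Hypothesis dopen : forall A : set Z, open A <->
  forall x, A x -> exists2 e : R, 0 < e & [set y | d x y < e] `<=` A.
Hypothesis Zcompact : compact [set: Z].
Variable sigma : seq (set Z) -> set Z * set Z.
Hypothesis sigma_strategy : strategyI X sigma.
Hypothesis sigma_wins : forall V : nat -> set Z,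
  (forall n, legalII (sigma (mkseq V n)) (V n)) ->
  ~ player_II_wins X (fun n => (sigma (mkseq V n)).2).
Variable reply : set Z * set Z -> nat -> set Z.
Hypothesis replyP : forall K U n, compact K -> open U -> K `<=` U ->
  [/\ open (reply (K, U) n), K `<=` reply (K, U) n,
      closure (reply (K, U) n) `<=` U & reply (K, U) n `<=` thickening d K n].

(* A node of the tree is a list in reverse order: [j :: s] is the j-th child of
   [s], and [u ++ s] is a descendant of [s]. *)
Fixpoint position (s : seq nat) : seq (set Z) :=
  if s is j :: s' then
    rcons (position s') (reply (sigma (position s')) (j + size s'))
  else [::].

Local Notation K_ s := (sigma (position s)).1.
Local Notation U_ s := (sigma (position s)).2.

Fixpoint compact_union (s : seq nat) : set Z :=
  if s is j :: s' then compact_union s' `|` K_ s else K_ [::].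

Local Notation L_ := compact_union.

Lemma position_legal s : legal_against sigma (position s).
Proof.
elim: s => [//|j s IH] i /=; rewrite size_rcons ltnS leq_eqVlt => /orP[/eqP ->|si].
  rewrite nth_rcons ltnn eqxx -cats1 take_size_cat//.
  have [[_ cK _] [oU KU _]] := sigma_strategy IH.
  move: cK oU KU; case: (sigma _) => K U /= cK oU KU.
  have [oV KV VU _] := replyP (j + size s) cK oU KU.
  by split=> //; apply: subset_trans VU; exact: subset_closure.
by rewrite nth_rcons si -cats1 takel_cat ?(ltnW si)//; exact: IH.
Qed.

Lemma positionP s : [/\ K_ s !=set0, compact (K_ s), K_ s `<=` X &
  open (U_ s) /\ K_ s `<=` U_ s].
Proof. by have [[? ? ?] [? ? _]] := sigma_strategy (@position_legal s). Qed.

Lemma position_replyP s j (V := reply (sigma (position s)) (j + size s)) :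
  [/\ open V, K_ s `<=` V, closure V `<=` U_ s &
      V `<=` thickening d (K_ s) (j + size s)].
Proof.
rewrite /V; have [_ + _ []] := positionP s.
by case: (sigma _) => K U /= cK oU KU; exact: replyP.
Qed.

Lemma position_cons_sub s j : U_ (j :: s) `<=` reply (sigma (position s)) (j + size s).
Proof.
by have [_ [_ _]] := sigma_strategy (@position_legal (j :: s)); rewrite /= last_rcons.
Qed.

Lemma compact_unionP s : [/\ L_ s !=set0, compact (L_ s) & L_ s `<=` X].
Proof.
elim: s => [|j s [L0 cL LX]]; first by have [] := positionP [::].
have [_ cK KX _] := positionP (j :: s).
split=> /=; first by case: L0 => x Lx; exists x; left.
  exact: compactU.
by rewrite subUset.
Qed.

Lemma K_compact_union s : K_ s `<=` L_ s.
Proof. by case: s => [|j s] //= x; right. Qed.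

Lemma compact_union_cat u s : L_ s `<=` L_ (u ++ s).
Proof. by elim: u => [//|j u IH] /= x /IH; left. Qed.

Lemma U_cat u s : U_ (u ++ s) `<=` U_ s.
Proof.
elim: u => [//|j u IH] /= x Ux; apply: IH.
have [_ _ + _] := position_replyP (u ++ s) j; apply.
by apply: subset_closure; exact: (@position_cons_sub (u ++ s) j).
Qed.

(** Any K_t with t at or below [j :: s] lies in U_(j :: s), hence in the reply labelled [j], hence
    in a thickening of K_s of index at least [j]. So whole subtrees, not only the children, converge
    to L_s. *)
Lemma compact_union_sub u s j :
  L_ (u ++ j :: s) `<=` L_ s `|` thickening d (L_ s) j.
Proof.
elim: u => [|i u IH] /= x.
  have -> : rcons (position s) (reply (sigma (position s)) (j + size s)) =
    position (j :: s) by [].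
  move=> [|Kx]; [by left|right].
  have [_ _ _ [_ KU]] := positionP (j :: s).
  have [_ _ _ +] := position_replyP s j.
  move=> /(_ x (position_cons_sub (KU _ Kx))).
  move=> /(le_thickening (leq_addr _ _)).
  exact: (thickeningS (@K_compact_union s)).
move=> [/IH//|Kx]; right.
have [_ _ _ [_ KU]] := positionP (i :: u ++ j :: s).
have /= Ux := @U_cat (i :: u) (j :: s) _ (KU _ Kx).
have [_ _ _ +] := position_replyP s j => /(_ x (position_cons_sub Ux)).
move=> /(le_thickening (leq_addr _ _)).
exact: (thickeningS (@K_compact_union s)).
Qed.

(** Otherwise the replies along [b] would win for player II. The bound [k0] admits branches
    controlled only from some stage on, as the proof of crowdedness requires. *)
Lemma no_branch_in_compact (b : nat -> seq nat) (M : set Z) k0 :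
  b 0%N = [::] -> (forall k, exists j, b k.+1 = j :: b k) ->
  compact M -> M `<=` X -> ~ (forall k, (k0 <= k)%N -> K_ (b k) `<=` M).
Proof.
move=> b0 bS cM MX bM; have /choice[f fP] := bS.
pose V k := reply (sigma (position (b k))) (f k + size (b k)).
have posE k : mkseq V k = position (b k).
  elim: k => [|k IH]; first by rewrite b0.
  by rewrite mkseqS fP IH.
have szb k : size (b k) = k.
  by elim: k => [|k IH]; [rewrite b0|rewrite fP /= IH].
have UV k : U_ (b k.+1) `<=` V k by rewrite fP; exact: position_cons_sub.
have VU k : closure (V k) `<=` U_ (b k).
  by have [_ _ + _] := position_replyP (b k) (f k).
(* The summand [size (b k)] of the index makes the thickenings shrink along the branch whatever
   children it takes. *)
have VK k : V k `<=` thickening d (K_ (b k)) k.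
  have [_ _ _ VT] := position_replyP (b k) (f k).
  apply: subset_trans VT _; apply: le_thickening.
  by rewrite szb leq_addl.
have U_mono m n : U_ (b (n + m)%N) `<=` U_ (b n).
  elim: m => [|m IH]; first by rewrite addn0.
  by rewrite addnS => z /UV Vz; apply/IH/VU/subset_closure.
apply: (sigma_wins (V := V)).
  move=> k; rewrite posE; have [oV KV cV _] := position_replyP (b k) (f k).
  by split=> //; apply: subset_trans cV; exact: subset_closure.
have -> : (fun n => (sigma (mkseq V n)).2) = (fun n => U_ (b n)).
  by apply/funext => n; rewrite posE.
split.
  (* Points chosen in the U_(b k) cluster in [Z], at a point in the closure of every V_n and thus in
     every U_(b n). *)
  have /choice[x xP] k : exists x, U_ (b k) x.
    by have [[x Kx] _ _ [_ KU]] := positionP (b k); exists x; exact: KU.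
  have [|z [_ clz]] := Zcompact (F := x @ \oo) _; first exact: filterT.
  exists z => n _; apply: VU => B Bz; apply: clz => //.
  exists n.+1 => // m /= nm; apply: UV; rewrite -(subnKC nm).
  exact: (U_mono _ _ _ (xP _)).
move=> z Uz; apply: MX.
apply: (compact_closed (metric_hausdorff dm dopen) cM).
apply: (bigcap_thickening dm dopen) => n.
have Vz := UV _ _ (Uz (maxn k0 n).+1 I).
have := VK _ _ Vz => /(le_thickening (leq_maxr k0 n)).
by apply: thickeningS; apply: bM; exact: leq_maxl.
Qed.

Lemma strategy_not_hereditarily_baire : ~ hereditarily_baire H.
Proof.
have hZ := metric_hausdorff dm dopen.
have shrinking (K U : set Z) : compact K -> open U -> K `<=` U ->
    exists V, [/\ open V, K `<=` V & closure V `<=` U].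
  move=> cK oU KU; have [oV KV VU _] := replyP 0 cK oU KU.
  by exists (reply (K, U) 0).
have /choice[x xE] s : exists x : H, trace x = L_ s.
  by have [L0 cL LX] := compact_unionP s; exact: trace_surj.
(* Membership in an open [U] passes from L_s to the larger union, so only the inclusion in [G]
   constrains [j]. *)
have nbhs_children s W : nbhs (x s) W ->
    exists J, forall j u, (J <= j)%N -> W (x (u ++ j :: s)).
  move=> /nbhs_trace[G [t [[oG LG] tP GtW]]]; rewrite xE in LG.
  have [_ cL _] := compact_unionP s.
  have [J JG] := compact_thickening dm dopen cL oG LG.
  exists J => j u Jj; apply: GtW.
    rewrite xE => z /compact_union_sub[/LG//|].
    by move=> /(le_thickening Jj) /JG.
  move=> U /tP[_ [z [+ Uz]]]; rewrite !xE => Lz; exists z; split=> //.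
  by rewrite -cat_rcons; exact: compact_union_cat.
move=> hB; apply: (@not_baire_countable _ _ x [::]); last first.
- apply: hB => M clM; apply: contrapT => nM.
  pose below s : set H := [set x (u ++ s) | u in setT].
  (* Some neighbourhood of [x s] whose closure misses [M] contains all but finitely many of the
     subtrees at children of [s], so [M] is in the closure of one of the others. *)
  have child s : exists j, closure (below s) M -> closure (below (j :: s)) M.
    have [clMs|] := pselect (closure (below s) M); last by exists 0%N.
    apply: contrapT => /forallNP nchild.
    have xM : x s <> M by move=> xM; apply: nM; exists s.
    have [W oW [Ws WM]] := hyperspace_T1 hZ xM.
    have [W' [oW' W's W'W]] :=
      hyperspace_regular shrinking (open_nbhs_nbhs (conj oW Ws)).
    have [J JW'] := nbhs_children s W' (open_nbhs_nbhs (conj oW' W's)).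
    have nbM n : exists2 B, nbhs M B &
        forall j u, (j < n)%N -> ~ B (x (u ++ j :: s)).
      elim: n => [|n [B MB Bn]]; first by exists setT => //; exact: filterT.
      have /existsNP[B' /not_implyP[MB' B'n]] : ~ closure (below (n :: s)) M.
        by move=> cln; apply: (nchild n).
      exists (B `&` B'); first exact: filterI.
      move=> j u; rewrite ltnS leq_eqVlt => /orP[/eqP jn|jn] [Bx B'x].
        rewrite jn in B'x; apply: B'n.
        by exists (x (u ++ n :: s)); split=> //; exists u.
      exact: (Bn _ _ jn Bx).
    have [B MB BJ] := nbM J.
    have MW' : nbhs M (~` closure W').
      apply: open_nbhs_nbhs; split; last by move=> /W'W.
      exact/closed_openC/closed_closure.
    have [_ [[u _ <-] [Bu W'u]]] := clMs _ (filterI MB MW').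
    (* The last entry of [u] is the child of [s] through which the node passes; an empty [u] is [s]
       itself. *)
    case/lastP: u => [|u j] in Bu W'u.
      by apply: W'u; exact: subset_closure.
    rewrite cat_rcons in Bu W'u.
    have [jJ|Jj] := ltnP j J; first exact: (BJ _ _ jJ Bu).
    by apply: W'u; apply: subset_closure; exact: JW'.
  have /choice[f fP] := child.
  pose b k := iter k (fun s => f s :: s) [::].
  have clb k : closure (below (b k)) M.
    elim: k => [|k IH]; last exact: fP.
    apply: closureS clM => _ [s _ <-]; exists s => //; by rewrite cats0.
  apply: (@no_branch_in_compact b (trace M) 0%N) => //.
  + by move=> k; exists (f (b k)).
  + exact: trace_compact.
  + exact: trace_sub.
  (* All L_(u ++ b k) contain K_(b k), and containing a given point is a closed condition, so [M]
     contains K_(b k). *)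
  move=> k _ z Kz.
  have cS : closed [set K : H | trace K `&` [set z] !=set0].
    apply: closed_trace_meet.
    exact/accessible_closed_set1/hausdorff_accessible.
  have [] : [set K : H | trace K `&` [set z] !=set0] M; last first.
    by move=> y [My <-].
  apply: cS; apply: closureS (clb k) => _ [u _ <-]; exists z; split=> //.
  by rewrite xE; apply/compact_union_cat/K_compact_union.
- move=> s W /nbhs_children[J JW]; apply: contrapT => nW.
  (* If [W] held no other value, every L below [t] would equal L_s. The branch [b] goes through [t],
     then takes child 0 forever by the default of [nth], and its compact sets stay in L_s from stage
     [size t] on. *)
  pose t := J :: s; pose b k := rev (mkseq (nth 0%N (rev t)) k).
  have [_ cL LX] := compact_unionP s.
  apply: (@no_branch_in_compact b (L_ s) (size t)) => //.
    by move=> k; exists (nth 0%N (rev t) k);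
      rewrite /b /mkseq -addn1 iotaD map_cat cats1 rev_rcons add0n.
  move=> k tk.
  have [u bE] : exists u, b k = u ++ t.
    rewrite /b -(subnKC tk) /mkseq iotaD map_cat rev_cat -/(mkseq _ _).
    rewrite -size_rev mkseq_nth revK; by eexists.
  apply: subset_trans (@K_compact_union (b k)) _.
  have -> : L_ (b k) = L_ s; last by [].
  rewrite -!xE bE; congr trace; apply: contrapT => ne; apply: nW.
  by exists (u ++ t) => //; exact: JW.
- by move=> s; exact: closed_hyperspace1.
Qed.

End closed_set_from_strategy.

Theorem mainTheorem2 (R : realType) (Z : topologicalType) (X : set Z)
    (Zcompact : compact [set: Z]) (Zmetrizable : metrizable R Z) :
  hereditarily_baire (hyperspace (set_type X)) <->
  ~ exists sigma : seq (set Z) -> set Z * set Z, winning_strategyI X sigma.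
Proof.
have [d dm dopen] := Zmetrizable; split; last first.
  move=> nS; apply: contrapT => /not_hereditarily_baire_strategy nB.
  apply/nS/nB => // K U cK oU KU.
  have [V [oV KV VU _]] := compact_shrink dm dopen 0 cK oU KU.
  by exists V.
move=> hB [sigma [sS sW]].
have /choice[reply replyP] : forall p : set Z * set Z * nat, exists V,
    compact p.1.1 -> open p.1.2 -> p.1.1 `<=` p.1.2 ->
    [/\ open V, p.1.1 `<=` V, closure V `<=` p.1.2
      & V `<=` thickening d p.1.1 p.2].
  move=> [[K U] n] /=.
  have [[cK oU KU]|np] := pselect [/\ compact K, open U & K `<=` U].
    by have [V VP] := compact_shrink dm dopen n cK oU KU; exists V.
  by exists setT => *; exfalso; exact: np.
apply: (strategy_not_hereditarily_baire dm dopen Zcompact sS sW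
  (reply := fun m n => reply (m, n)) _ hB).
by move=> K U n; exact: (replyP (K, U, n)).
Qed.
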